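(* For every $n\ge 1$, $\mathrm{sat}^*(n,\mathcal B)\ge n+1$; that is, every $\mathcal B$-saturated family of subsets of $[n]$ has at least $n+1$ members.
   Context: Subsets of $[n]=\{1,\dots,n\}$ are ordered by inclusion. For finite posets $\mathcal P$ and $\mathcal Q$, $\mathcal P$ contains an induced copy of $\mathcal Q$ if there is an injective map $f:\mathcal Q\to\mathcal P$ such that for all $a,b\in\mathcal Q$, $a\le b$ if and only if $f(a)\le f(b)$. A family $\mathcal F$ of subsets of $[n]$ is $\mathcal Q$-saturated if $\mathcal F$ contains no induced copy of $\mathcal Q$, but for every $S\subseteq[n]$ with $S\notin\mathcal F$, $\mathcal F\cup\{S\}$ contains an induced copy of $\mathcal Q$. The induced saturation number $\mathrm{sat}^*(n,\mathcal Q)$ is the minimum size of a $\mathcal Q$-saturated family of subsets of $[n]$. The butterfly $\mathcal B$ is the four-element poset $\{a_1,a_2,b_1,b_2\}$ in which $a_1,a_2$ are incomparable, $b_1,b_2$ are incomparable, and $a_i<b_j$ for all $i,j\in\{1,2\}$ (no other relations). *)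

(* Defs.v *)
From HB Require Import structures.
From mathcomp Require Import all_boot all_order.

Set Implicit Arguments.
Unset Strict Implicit.
Unset Printing Implicit Defensive.

Import Order.TTheory.

Section Saturation.
Variables (n : nat) (d : Order.disp_t) (Q : finPOrderType d).
Implicit Types (F : {set {set 'I_n}}) (S : {set 'I_n}).

Definition contains_copy F : bool :=
  [exists f : {ffun Q -> {set 'I_n}},
    [&& injectiveb f,
        [forall a, f a \in F] &
        [forall a, forall b, (a <= b)%O == (f a \subset f b)]]].

Definition saturated F : bool :=
  ~~ contains_copy F &&
  [forall S, (S \notin F) ==> contains_copy (S |: F)].

(* The default value of the arg min, the family of all subsets, only matters
   when Q is empty: see [sat_starP]. *)
Definition sat_star : nat :=
  #|[arg min_(F < [set: {set 'I_n}] | saturated F) #|F| ]|.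

Lemma contains_copyP F :
  reflect (exists f : Q -> {set 'I_n},
             [/\ injective f, forall a, f a \in F &
                 forall a b, (a <= b)%O <-> f a \subset f b])
          (contains_copy F).
Proof.
apply: (iffP existsP) => [[f /and3P[/injectiveP fI /forallP fF /forallP fle]]|].
  exists f; split=> // a b.
  by have /forallP/(_ b)/eqP -> := fle a.
move=> [f [fI fF fle]]; exists (finfun f); apply/and3P; split.
- by apply/injectiveP => a b; rewrite !ffunE => /fI.
- by apply/forallP => a; rewrite ffunE.
- apply/forallP => a; apply/forallP => b; rewrite !ffunE.
  by apply/eqP; apply/idP/idP => /fle.
Qed.

Lemma saturatedP F :
  reflect (~ contains_copy F /\ forall S, S \notin F -> contains_copy (S |: F))
          (saturated F).
Proof.
apply: (iffP andP) => [[/negP nF /forallP sF]|[/negP nF sF]]; split=> //.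
  by move=> S; apply/implyP.
by apply/forallP => S; apply/implyP/sF.
Qed.

Lemma saturated_exists : 0 < #|Q| -> exists F, saturated F.
Proof.
move=> /card_gt0P[q _].
have : ~~ contains_copy set0.
  by apply/contains_copyP => -[f [_ /(_ q)]]; rewrite inE.
move=> /(ex_intro (fun F => is_true (~~ contains_copy F)) set0).
move=> /(@ex_maxset _ (fun F => ~~ contains_copy F))[F /maxsetP[nF maxF]].
exists F; rewrite /saturated nF; apply/forallP => S; apply/implyP => SF.
case: (boolP (contains_copy _)) => // /maxF/(_ (subsetUr _ _)) SFE.
by rewrite -SFE setU11 in SF.
Qed.

Lemma sat_starP : 0 < #|Q| ->
  (exists2 F, saturated F & #|F| = sat_star) /\
  (forall F, saturated F -> sat_star <= #|F|).
Proof.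
move=> /saturated_exists[F0 sF0]; rewrite /sat_star /arg_min /extremum.
case: pickP => [F /andP[sF /forallP minF]|none].
  by split=> [|G sG]; [exists F | have /implyP := minF G; apply].
have [F sF minF] := arg_minnP (fun F : {set {set 'I_n}} => #|F|) sF0.
have /negP[] := negbT (none F); apply/andP; split=> //.
by apply/forallP => G; apply/implyP => /minF.
Qed.

End Saturation.

Arguments contains_copy {n d} Q F.
Arguments saturated {n d} Q F.
Arguments sat_star n {d} Q.

Inductive butterfly : Type := Ba1 | Ba2 | Bb1 | Bb2.

Definition butterfly_code (x : butterfly) : bool * bool :=
  match x with
  | Ba1 => (false, false) | Ba2 => (false, true)
  | Bb1 => (true, false) | Bb2 => (true, true)
  end.

Definition butterfly_decode (p : bool * bool) : butterfly :=
  match p with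
  | (false, false) => Ba1 | (false, true) => Ba2
  | (true, false) => Bb1 | (true, true) => Bb2
  end.

Lemma butterfly_codeK : cancel butterfly_code butterfly_decode.
Proof. by case. Qed.

HB.instance Definition _ := Finite.copy butterfly (can_type butterfly_codeK).

Definition butterfly_le (x y : butterfly) : bool :=
  match x, y with
  | Ba1, Bb1 | Ba1, Bb2 | Ba2, Bb1 | Ba2, Bb2 => true
  | _, _ => x == y
  end.

Lemma butterfly_le_refl : reflexive butterfly_le.
Proof. by case. Qed.

Lemma butterfly_le_anti : antisymmetric butterfly_le.
Proof. by do 2!case. Qed.

Lemma butterfly_le_trans : transitive butterfly_le.
Proof. by do 3!case. Qed.

Fact butterfly_display : Order.disp_t. Proof. exact: Order.Disp tt tt. Qed.

HB.instance Definition _ :=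
  Order.Le_isPOrder.Build butterfly_display butterfly
    butterfly_le_refl butterfly_le_anti butterfly_le_trans.

(* Main.v *)
Require Import Defs.
From mathcomp Require Import all_boot all_order.

(** In a butterfly-saturated family F, every i in [n] admits a set A avoiding i
    with A and A + i both in F.  If {i} is not in F, adding
    {i} makes it a lower element of a butterfly, so some A in F avoids i while
    A + i lies below two incomparable members of F; a maximal such A has A + i in
    F, since a butterfly created by A + i would yield one inside F or a larger
    such A (take A empty when {i} is in F, as F contains the empty set).  Thus the
    hypercube graph induced on F has an edge in each of the n directions.  Edges
    in pairwise distinct directions form a forest: contracting a direction
    i (A |-> A - i) merges two members of F and keeps the other directions, so
    |F| >= n + 1 by induction. *)

Definition incomparable {T : finType} (A B : {set T}) : bool :=
  ~~ (A \subset B) && ~~ (B \subset A).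

Lemma incomparableC {T : finType} (A B : {set T}) :
  incomparable A B = incomparable B A.
Proof. by rewrite /incomparable andbC. Qed.

Lemma incomparable_neq {T : finType} (A B : {set T}) :
  incomparable A B -> A != B.
Proof. by case/andP=> + _; apply: contraNneq => ->. Qed.

Section ButterflyCopies.
Variable n : nat.
Implicit Types (F : {set {set 'I_n}}) (S A B C D : {set 'I_n}).

(** Injectivity and the absence of an upper set below a lower one come for free: [B1 \subset A1]
    would give [A2 \subset B1 \subset A1], against incomparability, and likewise for the other
    pairs. *)
Lemma butterfly_copyP F :
  reflect (exists A1 A2 B1 B2,
             [/\ {subset [:: A1; A2; B1; B2] <= F},
                 incomparable A1 A2, incomparable B1 B2 &
                 [&& A1 \subset B1, A1 \subset B2, A2 \subset B1 &
                     A2 \subset B2]])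
          (contains_copy butterfly F).
Proof.
apply: (iffP (contains_copyP _ _)) => [[f [_ fF fle]]|].
  have nle x y : ~~ (x <= y)%O -> ~~ (f x \subset f y).
    by apply: contraNN => /fle.
  exists (f Ba1), (f Ba2), (f Bb1), (f Bb2); split.
  - by apply/allP; rewrite /= !fF.
  - by rewrite /incomparable !nle.
  - by rewrite /incomparable !nle.
  - by apply/and4P; split; apply/fle.
move=> [A1 [A2 [B1 [B2 [/allP/and5P[A1F A2F B1F B2F _]]]]]].
move=> /andP[A12 A21] /andP[B12 B21] /and4P[A1B1 A1B2 A2B1 A2B2].
pose f x := match x with Ba1 => A1 | Ba2 => A2 | Bb1 => B1 | Bb2 => B2 end.
have fle x y : (x <= y)%O <-> f x \subset f y.
  suff -> : (f x \subset f y) = (x <= y)%O by [].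
  have BA11 : ~~ (B1 \subset A1) by apply: contraNN A21; apply: subset_trans.
  have BA12 : ~~ (B1 \subset A2) by apply: contraNN A12; apply: subset_trans.
  have BA21 : ~~ (B2 \subset A1) by apply: contraNN A21; apply: subset_trans.
  have BA22 : ~~ (B2 \subset A2) by apply: contraNN A12; apply: subset_trans.
  by case: x; case: y; rewrite /= ?subxx //; apply/negbTE.
exists f; split=> //; last by case.
by move=> x y fxy; apply/Order.POrderTheory.le_anti/andP; split; apply/fle;
  rewrite fxy.
Qed.

Lemma saturated_butterfly_free F A1 A2 B1 B2 :
  saturated butterfly F -> A1 \in F -> A2 \in F -> B1 \in F -> B2 \in F ->
  incomparable A1 A2 -> incomparable B1 B2 ->
  A1 \subset B1 -> A1 \subset B2 -> A2 \subset B1 -> A2 \subset B2 -> False.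
Proof.
move=> /saturatedP[nF _] A1F A2F B1F B2F A12 B12 A1B1 A1B2 A2B1 A2B2.
apply/nF/butterfly_copyP; exists A1, A2, B1, B2.
by split=> //; [apply/allP/and5P | apply/and4P].
Qed.

(** The new copy must use [S], since [F] alone has none. The two alternatives are [S] as a lower and
    as an upper element; the other three sets differ from [S], so they lie in [F]. *)
Lemma saturated_butterfly_add F S : saturated butterfly F -> S \notin F ->
  (exists C D1 D2, [/\ C \in F, D1 \in F & D2 \in F] /\
     [/\ incomparable S C, incomparable D1 D2 &
         [&& S \subset D1, S \subset D2, C \subset D1 & C \subset D2]]) \/
  (exists D C1 C2, [/\ D \in F, C1 \in F & C2 \in F] /\
     [/\ incomparable S D, incomparable C1 C2 &
         [&& C1 \subset S, C2 \subset S, C1 \subset D & C2 \subset D]]).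
Proof.
move=> sF SF; have /saturatedP[_ /(_ S SF)] := sF.
move=> /butterfly_copyP[A1 [A2 [B1 [B2 [/allP/and5P[]]]]]].
rewrite !in_setU1 => A1S A2S B1S B2S _ A12 B12 /and4P[A1B1 A1B2 A2B1 A2B2].
have inF X Y : incomparable X Y -> X = S -> (Y == S) || (Y \in F) -> Y \in F.
  by move=> /incomparable_neq + XS; rewrite -XS eq_sym => /negbTE ->.
have notS X Y Z : (Z == S) || (Z \in F) -> X = S -> incomparable X Y ->
    Y \subset Z -> Z \in F.
  by move=> /orP[/eqP-> ->|//] /andP[_ /negbTE ->].
have A21 : incomparable A2 A1 by rewrite incomparableC.
case/orP: (A1S) => [/eqP E|A1F].
  left; exists A2, B1, B2; rewrite -E; split; split=> //.
  - exact: inF A12 E A2S.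
  - exact: notS B1S E A12 A2B1.
  - exact: notS B2S E A12 A2B2.
  - exact/and4P.
case/orP: (A2S) => [/eqP E|A2F].
  left; exists A1, B1, B2; rewrite -E; split; split=> //.
  - exact: notS B1S E A21 A1B1.
  - exact: notS B2S E A21 A1B2.
  - exact/and4P.
case/orP: (B1S) => [/eqP E|B1F].
  right; exists B2, A1, A2; rewrite -E; split; split=> //.
  - exact: inF B12 E B2S.
  - exact/and4P.
case/orP: (B2S) => [/eqP E|B2F].
  right; exists B1, A1, A2; rewrite -E; split; split=> //.
  - by rewrite incomparableC.
  - exact/and4P.
by case: (saturated_butterfly_free F A1 A2 B1 B2).
Qed.

(** Each element of a butterfly is incomparable to another one, whereas the empty set is comparable
    to every set. *)
Lemma saturated_butterfly_set0 F : saturated butterfly F -> set0 \in F.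
Proof.
move=> sF; apply/negPn/negP => /(saturated_butterfly_add _ _ sF)[].
  by move=> [C [D1 [D2 [_ [/andP[]]]]]]; rewrite sub0set.
by move=> [D [C1 [C2 [_ [/andP[]]]]]]; rewrite sub0set.
Qed.

Lemma saturated_butterfly_edge F (i : 'I_n) : saturated butterfly F ->
  exists A, [/\ A \in F, i |: A \in F & i \notin A].
Proof.
move=> sF; have [iF|niF] := boolP ([set i] \in F).
  exists set0; rewrite setU0 inE; split=> //; exact: saturated_butterfly_set0.
pose P A := [&& A \in F, i \notin A &
  [exists D1 in F, exists D2 in F,
    [&& incomparable D1 D2, i |: A \subset D1 & i |: A \subset D2]]].
have PI A D1 D2 : A \in F -> i \notin A -> D1 \in F -> D2 \in F ->
    incomparable D1 D2 -> i |: A \subset D1 -> i |: A \subset D2 -> P A.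
  move=> AF iA D1F D2F D12 AD1 AD2; apply/and3P; split=> //.
  by apply/exists_inP; exists D1 => //; apply/exists_inP; exists D2;
     rewrite // D12 AD1.
have [A0 PA0] : exists A, P A.
  case: (saturated_butterfly_add _ _ sF niF).
    move=> [C [D1 [D2 [[CF D1F D2F] [iC D12 /and4P[iD1 iD2 CD1 CD2]]]]]].
    exists C; apply: (PI C D1 D2) => //; rewrite ?subUset ?iD1 ?iD2 //.
    by case/andP: iC; rewrite sub1set.
  (* The set [[set i]] cannot be an upper element: its only subsets are itself and the empty set,
     which are comparable. *)
  move=> [D [C1 [C2 [_ [_ /andP[C12 C21] /and4P[]]]]]].
  rewrite !subset1 => /orP[] /eqP E1.
    by move=> /orP[] /eqP E2; move: C21; rewrite E2 ?E1 ?sub0set ?subxx.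
  by move: C12; rewrite E1 sub0set.
have [A /maxsetP[/and3P[AF iA /exists_inP[D1 D1F /exists_inP[D2 D2F]]]]] :=
  @ex_maxset _ P (ex_intro _ A0 PA0).
move=> /and3P[D12 AD1 AD2] maxA; exists A; split=> //.
apply/negPn/negP => /(saturated_butterfly_add _ _ sF)[].
  (* Here [i |: A] is a lower element, with partner [C]. Either [A] and [C] are incomparable and
     form a butterfly in [F] with [E1] and [E2], or [C] strictly contains [A], avoids [i] and
     satisfies [P], against maximality. *)
  move=> [C [E1 [E2 [[CF E1F E2F] [AC E12 /and4P[AE1 AE2 CE1 CE2]]]]]].
  case/andP: AC => nAC nCA.
  have /andP[iE1 AE1'] : (i \in E1) && (A \subset E1).
    by rewrite -sub1set -subUset.
  have /andP[iE2 AE2'] : (i \in E2) && (A \subset E2).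
    by rewrite -sub1set -subUset.
  have nCA' : ~~ (C \subset A).
    by apply: contraNN nCA => /subset_trans; apply; apply: subsetUr.
  have [sAC|nAC'] := boolP (A \subset C); last first.
    by apply: (saturated_butterfly_free F A C E1 E2) => //; apply/andP.
  have iC : i \notin C.
    by apply: contraNN nAC => iC; rewrite subUset sub1set iC.
  have PC : P C by apply: (PI C E1 E2); rewrite // subUset sub1set ?iE1 ?iE2.
  by move: nCA'; rewrite (maxA C PC sAC) subxx.
(* Here [i |: A] is an upper element: [C1] and [C2] lie below it, hence below both [D1] and [D2],
   which gives a butterfly inside [F]. *)
move=> [D [C1 [C2 [[_ C1F C2F] [_ C12 /and4P[C1A C2A _ _]]]]]].
by apply: (saturated_butterfly_free F C1 C2 D1 D2) => //;
   [ apply: subset_trans AD1 | apply: subset_trans AD2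
   | apply: subset_trans AD1 | apply: subset_trans AD2].
Qed.

End ButterflyCopies.

Lemma card_distinct_directions (T : finType) (I : {set T})
    (F : {set {set T}}) : F != set0 ->
  (forall i, i \in I -> exists A, [/\ A \in F, i |: A \in F & i \notin A]) ->
  #|I| < #|F|.
Proof.
have [m] := ubnP #|I|; elim: m I F => // m IHm I F ltIm F0 edge.
have [->|[i iI]] := set_0Vmem I; first by rewrite cards0 card_gt0.
pose F' := [set A :\ i | A in F].
(* The contraction is not injective on [F]: the two ends of the edge in direction [i] have the same
   image. *)
have ltF : #|F'| < #|F|.
  rewrite ltn_neqAle leq_imset_card andbT; apply/negP => /imset_injP inj.
  have [A [AF iAF iA]] := edge i iI.
  have /inj : (i |: A) :\ i = A :\ i by rewrite setDUl setDv set0U.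
  by move=> /(_ iAF AF) E; move: iA; rewrite -E setU11.
have cI : #|I| = #|I :\ i|.+1 by rewrite (cardsD1 i) iI.
rewrite cI; apply: leq_ltn_trans ltF; apply: IHm.
- by rewrite cI ltnS in ltIm.
- by case/set0Pn: F0 => A AF; apply/set0Pn; exists (A :\ i); apply: imset_f.
move=> j /setD1P[ji jI]; have [A [AF jAF jA]] := edge j jI.
exists (A :\ i); split; first exact: imset_f.
  (* Adding [j] commutes with deleting [i] because [j] differs from [i], so the edge in direction
     [j] survives the contraction. *)
  suff -> : j |: A :\ i = (j |: A) :\ i by apply: imset_f.
  by apply/setP => x; rewrite !inE; have [->|//] := eqVneq x j; rewrite ji.
by rewrite !inE negb_and jA orbT.
Qed.

Theorem theorem2 (n : nat) (n_ge1 : 1 <= n) :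
  n.+1 <= sat_star n butterfly /\
  (forall F : {set {set 'I_n}}, saturated butterfly F -> n.+1 <= #|F|).
Proof.
have bound (F : {set {set 'I_n}}) : saturated butterfly F -> n.+1 <= #|F|.
  move=> sF; rewrite -[n in n.+1]card_ord -cardsT.
  apply: card_distinct_directions => [|i _].
    by apply/set0Pn; exists set0; apply: saturated_butterfly_set0.
  exact: saturated_butterfly_edge.
split=> //.
(* Nonemptiness of the poset guarantees that [sat_star] is the size of an actual saturated family,
   not of the default value of the arg min. *)
have Q_gt0 : 0 < #|{: butterfly}| by apply/card_gt0P; exists Ba1.
by have [[F /bound + <-] _] := sat_starP n Q_gt0.
Qed.
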